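(* Let $(N,g)$ be the simply connected two-step nilpotent Lie group with left-invariant metric determined by a linear space $J_{\mathfrak z}$ of skew endomorphisms of a Euclidean space $\mathfrak v$, as defined in the context, with $r=\dim\mathfrak z$, and let $\Gamma_Z$ be a lattice in the center $\mathfrak z$. The Laplacian of $(N,g)$ acting on functions is $$\Delta=\Delta_X+\Delta_Z+\frac14\sum_{\alpha,\beta=1}^r\langle J_\alpha(X),J_\beta(X)\rangle\,\partial^2_{\alpha\beta}+\sum_{\alpha=1}^r\partial_\alpha D_\alpha\bullet .$$ Moreover, for every $\mathcal Z_\gamma\in\Gamma_Z$, the space of functions of the form $\Psi(X,Z)=\psi(X)e^{2\pi\mathbf{i}\langle\mathcal Z_\gamma,Z\rangle}$ is invariant under $\Delta$, and for every smooth $\psi:\mathfrak v\to\mathbb{C}$, $$\Delta\Psi(X,Z)=(\square_{(\gamma)}\psi)(X)\,e^{2\pi\mathbf{i}\langle\mathcal Z_\gamma,Z\rangle},\qquad \square_{(\gamma)}=\Delta_X+2\pi\mathbf{i}D_{(\gamma)}\bullet-4\pi^2\Bigl(|\mathcal Z_\gamma|^2+\frac14|J_{\mathcal Z_\gamma}(X)|^2\Bigr),$$ where $D_{(\gamma)}\bullet$ is the directional derivative along the vector field $X\mapsto J_{\mathcal Z_\gamma}(X)$ on $\mathfrak v$.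
   Context: Let $\mathfrak v$ be a Euclidean space and $J_{\mathfrak z}$ a linear space of skew-symmetric endomorphisms of $\mathfrak v$. Let $\mathfrak z$ be an abstract vector space identified with $J_{\mathfrak z}$ through $Z\mapsto J_Z$, with inner product $\langle Z_1,Z_2\rangle=-\mathrm{Tr}(J_{Z_1}\circ J_{Z_2})$. On the orthogonal direct sum $\mathfrak n=\mathfrak v\oplus\mathfrak z$ the bracket has $\mathfrak z$ in the center, $[\mathfrak v,\mathfrak v]\subset\mathfrak z$, and $\langle[X,Y],Z\rangle=\langle J_Z(X),Y\rangle$ for $X,Y\in\mathfrak v$, $Z\in\mathfrak z$. The group $N$ is identified with $\mathfrak n$ by the exponential map, with product $(X,Z)(X^*,Z^* )=(X+X^*,Z+Z^*+\frac12[X,X^*])$; $g$ is the left-invariant metric extending $\langle\,,\rangle$ from the identity. $\{e_1,\dots,e_r\}$ is an orthonormal basis of $\mathfrak z$, $J_\alpha=J_{e_\alpha}$, $\partial_\alpha$ is the derivative in the coordinate along $e_\alpha$, $\partial^2_{\alpha\beta}=\partial_\alpha\partial_\beta$, $D_\alpha\bullet$ is the directional derivative along the vector field $X\mapsto J_\alpha(X)$ on $\mathfrak v$, $\Delta_X$ and $\Delta_Z$ are the Euclidean Laplacians on $\mathfrak v$ and $\mathfrak z$. Laplacians are the analysts' (nonpositive) ones and $\mathbf{i}=\sqrt{-1}$. *)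

(* Defs.v *)
(* MathComp, MathComp-Analysis, and R[i] from mathcomp-real-closed. *)
From HB Require Import structures.
From mathcomp Require Import all_boot all_order all_algebra.
From mathcomp Require Import all_classical all_reals all_analysis.
From mathcomp Require Import complex ring.

Set Implicit Arguments.
Unset Strict Implicit.
Unset Printing Implicit Defensive.

Import Order.TTheory GRing.Theory Num.Theory.
Import numFieldNormedType.Exports.

Local Open Scope classical_set_scope.
Local Open Scope complex_scope.
Local Open Scope ring_scope.

(* On a finite-dimensional space, [contdiff k f] is the usual notion of a
   function of class C^k: f is differentiable and each component
   x |-> 'd f x v of its differential is of class C^(k-1). *)
Fixpoint contdiff (R : realType) (V : normedModType R) (k : nat) (f : V -> R)
    : Prop :=
  if k is k'.+1 then
    (forall x, differentiable f x) /\ (forall v, contdiff k' ('D_v f))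
  else continuous f.

Definition smooth (R : realType) (V : normedModType R) (f : V -> R) : Prop :=
  forall k, contdiff k f.

Definition csmooth (R : realType) (V : normedModType R) (f : V -> R[i]) : Prop :=
  smooth (fun x => complex.Re (f x)) /\ smooth (fun x => complex.Im (f x)).

(* R[i] is not a normed module over R, so derivatives along real vectors are
   taken separately on the real and imaginary parts. *)
Definition cderive (R : realType) (V : normedModType R) (v : V)
    (f : V -> R[i]) : V -> R[i] :=
  fun x => 'D_v (fun y => complex.Re (f y)) x +i*
           'D_v (fun y => complex.Im (f y)) x.

(* Derivative along a vector field, f |-> (x |-> df_x(F x)). *)
Definition cderive_field (R : realType) (V : normedModType R) (F : V -> V)
    (f : V -> R[i]) : V -> R[i] :=
  fun x => cderive (F x) f x.

Definition cexpi (R : realType) (t : R) : R[i] := cos t +i* sin t.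

(* The Laplace-Beltrami operator div grad of a Riemannian metric g on R^n, in
   the global coordinates:
     (det g)^(-1/2) sum_(i,j) d_i ((det g)^(1/2) g^(ij) d_j f). *)
Section LaplaceBeltrami.
Variables (R : realType) (n : nat).
Variable g : 'rV[R]_n -> 'rV[R]_n -> 'rV[R]_n -> R.

Definition gram (x : 'rV[R]_n) : 'M[R]_n :=
  \matrix_(i, j) g x (delta_mx 0 i) (delta_mx 0 j).

Definition vol_density (x : 'rV[R]_n) : R := Num.sqrt (\det (gram x)).

Definition laplace_beltrami (f : 'rV[R]_n -> R[i]) : 'rV[R]_n -> R[i] :=
  fun x => ((vol_density x)^-1)%:C *
    \sum_(i < n) \sum_(j < n)
      cderive (delta_mx 0 i)
        (fun y => (vol_density y * invmx (gram y) i j)%:C *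
                  cderive (delta_mx 0 j) f y) x.

End LaplaceBeltrami.

Definition dot (R : realType) (m : nat) (X Y : 'rV[R]_m) : R :=
  \sum_(i < m) X 0 i * Y 0 i.

(* v is R^m with its standard inner product, and an endomorphism of v is given
   by a matrix A acting on row vectors, X |-> X *m A.  z is described by its
   coordinates in a basis e of J_z: the row vector Z stands for the vector with
   J_Z = sum_a Z_a e_a.  N is the set of the row_mx X Z. *)
Section Nilpotent.
Variables (R : realType) (m r : nat) (e : r.-tuple 'M[R]_m).

Definition Jmx (Z : 'rV[R]_r) : 'M[R]_m := \sum_(a < r) Z 0 a *: tnth e a.

Definition Jact (Z : 'rV[R]_r) (X : 'rV[R]_m) : 'rV[R]_m := X *m Jmx Z.

Definition evec (a : 'I_r) : 'rV[R]_r := delta_mx 0 a.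

Definition zdot (Z1 Z2 : 'rV[R]_r) : R := - \tr (Jmx Z1 *m Jmx Z2).

(* For orthonormal e this is the bracket determined by
   <[X, Y], Z> = <J_Z(X), Y>; see [brP]. *)
Definition br (X Y : 'rV[R]_m) : 'rV[R]_r :=
  \row_(a < r) dot (Jact (evec a) X) Y.

Definition ndot (p q : 'rV[R]_(m + r)) : R :=
  dot (lsubmx p) (lsubmx q) + zdot (rsubmx p) (rsubmx q).

Definition nmul (p q : 'rV[R]_(m + r)) : 'rV[R]_(m + r) :=
  row_mx (lsubmx p + lsubmx q)
         (rsubmx p + rsubmx q + 2^-1 *: br (lsubmx p) (lsubmx q)).

Definition ninv (p : 'rV[R]_(m + r)) : 'rV[R]_(m + r) := - p.

(* Tangent vectors at p are moved to the identity by the differential of the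
   left translation by the inverse of p; see [nmetric_left] and [nmetric1]. *)
Definition nmetric (p u w : 'rV[R]_(m + r)) : R :=
  ndot ('d (nmul (ninv p)) p u) ('d (nmul (ninv p)) p w).

Definition nlaplacian : ('rV[R]_(m + r) -> R[i]) -> 'rV[R]_(m + r) -> R[i] :=
  laplace_beltrami nmetric.

Definition vdir (X : 'rV[R]_m) : 'rV[R]_(m + r) := row_mx X 0.
Definition zdir (Z : 'rV[R]_r) : 'rV[R]_(m + r) := row_mx 0 Z.

Definition lap_v (f : 'rV[R]_(m + r) -> R[i]) : 'rV[R]_(m + r) -> R[i] :=
  fun p => \sum_(i < m) cderive (vdir (delta_mx 0 i))
                          (cderive (vdir (delta_mx 0 i)) f) p.

Definition dz (a : 'I_r) (f : 'rV[R]_(m + r) -> R[i]) :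
    'rV[R]_(m + r) -> R[i] := cderive (zdir (evec a)) f.

Definition lap_z (f : 'rV[R]_(m + r) -> R[i]) : 'rV[R]_(m + r) -> R[i] :=
  fun p => \sum_(a < r) dz a (dz a f) p.

Definition Dv (a : 'I_r) (f : 'rV[R]_(m + r) -> R[i]) :
    'rV[R]_(m + r) -> R[i] :=
  cderive_field (fun p => vdir (Jact (evec a) (lsubmx p))) f.

Definition lapX (psi : 'rV[R]_m -> R[i]) : 'rV[R]_m -> R[i] :=
  fun X => \sum_(i < m) cderive (delta_mx 0 i) (cderive (delta_mx 0 i) psi) X.

Definition fourier_mode (Zg : 'rV[R]_r) (psi : 'rV[R]_m -> R[i]) :
    'rV[R]_(m + r) -> R[i] :=
  fun p => psi (lsubmx p) * cexpi (2 * pi * zdot Zg (rsubmx p)).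

Definition mode_space (Zg : 'rV[R]_r) : set ('rV[R]_(m + r) -> R[i]) :=
  [set Psi | exists2 psi, csmooth psi & Psi = fourier_mode Zg psi].

Definition box (Zg : 'rV[R]_r) (psi : 'rV[R]_m -> R[i]) : 'rV[R]_m -> R[i] :=
  fun X => lapX psi X
    + (2 * pi)%:C * 'i%C * cderive_field (Jact Zg) psi X
    - (4 * pi ^+ 2 * (zdot Zg Zg + 4^-1 * dot (Jact Zg X) (Jact Zg X)))%:C * psi X.

End Nilpotent.

Arguments evec {R r} a.

(* With e orthonormal and skew, nmul is a group law and nmetric is the
   left-invariant metric extending ndot. *)
Section Consistency.
Variables (R : realType) (m r : nat) (e : r.-tuple 'M[R]_m).
Hypothesis e_on : forall a b : 'I_r, - \tr (tnth e a *m tnth e b) = (a == b)%:R.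
Hypothesis e_skew : forall a : 'I_r, (tnth e a)^T = - tnth e a.

Lemma dotE (X Y : 'rV[R]_m) : dot X Y = (X *m Y^T) 0 0.
Proof. by rewrite mxE; apply: eq_bigr => i _; rewrite mxE. Qed.

Lemma Jmx_evec a : Jmx e (evec a) = tnth e a.
Proof.
rewrite /Jmx (bigD1 a) //= big1 ?addr0 => [|b ba].
  by rewrite mxE !eqxx scale1r.
by rewrite mxE eqxx (negbTE ba) scale0r.
Qed.

Lemma zdotE Z1 Z2 : zdot e Z1 Z2 = dot Z1 Z2.
Proof.
have tr_sum (F : 'I_r -> 'M[R]_m) : \tr (\sum_a F a) = \sum_a \tr (F a).
  exact: raddf_sum.
rewrite /zdot /Jmx (@mulmx_suml R m m m) (@tr_sum (fun a => _)) -sumrN.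
apply: eq_bigr => a _ /=.
rewrite (@mulmx_sumr R m m m) (@tr_sum (fun a => _)) -sumrN.
rewrite (bigD1 a) //= big1 => [|b ba].
  by rewrite addr0 -scalemxAl -scalemxAr !mxtraceZ -!mulrN e_on eqxx mulr1.
by rewrite -scalemxAl -scalemxAr !mxtraceZ -!mulrN e_on eq_sym (negbTE ba) !mulr0.
Qed.

Lemma brP X Y Z : zdot e (br e X Y) Z = dot (Jact e Z X) Y.
Proof.
have -> : Jact e Z X = \sum_a Z 0 a *: (X *m tnth e a).
  rewrite /Jact /Jmx (@mulmx_sumr R 1 m m); apply: eq_bigr => a _.
  by rewrite -scalemxAr.
rewrite zdotE [in RHS]dotE (@mulmx_suml R 1 m 1) summxE.
apply: eq_bigr => a _; rewrite [br _ _ _ _ _]mxE -scalemxAl [RHS]mxE mulrC dotE.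
by rewrite /Jact Jmx_evec.
Qed.

Fact br_is_linear X : linear (br e X).
Proof.
move=> k Y Y'; apply/rowP => a; rewrite !mxE !dotE linearP /= mulmxDr.
by rewrite -scalemxAr !mxE.
Qed.

Lemma br0 X : br e X 0 = 0.
Proof. by apply/rowP => a; rewrite !mxE dotE trmx0 mulmx0 mxE. Qed.

Lemma br_anti X Y : br e X Y = - br e Y X.
Proof.
apply/rowP => a; rewrite !mxE !dotE /Jact Jmx_evec.
have -> (M : 'M[R]_1) : M 0 0 = M^T 0 0 by rewrite mxE.
by rewrite !trmx_mul trmxK e_skew mulmxA mulmxN mulNmx mxE.
Qed.

Lemma brDr X Y Y' : br e X (Y + Y') = br e X Y + br e X Y'.
Proof. by have := br_is_linear X 1 Y Y'; rewrite !scale1r. Qed.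

Lemma brDl X Y Y' : br e (X + Y) Y' = br e X Y' + br e Y Y'.
Proof. by rewrite br_anti brDr opprD -!br_anti. Qed.

Lemma brNl X Y : br e (- X) Y = - br e X Y.
Proof. by apply/eqP; rewrite -addr_eq0 -brDl addNr br_anti br0 oppr0. Qed.

Lemma brxx X : br e X X = 0.
Proof.
apply/rowP => a; rewrite [RHS]mxE; have /rowP/(_ a) := br_anti X X.
by rewrite [X in _ = X]mxE => /eqP; rewrite -addr_eq0 -mulr2n mulrn_eq0 /= => /eqP.
Qed.

Lemma nmulA p q s : nmul e p (nmul e q s) = nmul e (nmul e p q) s.
Proof.
rewrite /nmul !row_mxKl !row_mxKr !brDl !brDr !scalerDr; congr row_mx.
  by rewrite addrA.
move: (br e _ _) (br e _ _) (br e _ _) => x y z.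
by apply/rowP => a; rewrite !mxE; ring.
Qed.

Lemma nmul0 p : nmul e 0 p = p.
Proof. by rewrite /nmul !linear0 br_anti br0 oppr0 scaler0 !add0r addr0 hsubmxK. Qed.

Lemma nmulV p : nmul e (ninv p) p = 0.
Proof. by rewrite /nmul /ninv !linearN /= brNl brxx oppr0 scaler0 addr0 !addNr row_mx0. Qed.

(* The differential of nmul p, at any point; see [diff_nmul]. *)
Definition dnmul (p q : 'rV[R]_(m + r)) : 'rV[R]_(m + r) :=
  row_mx (lsubmx q) (rsubmx q + 2^-1 *: br e (lsubmx p) (lsubmx q)).

Fact dnmul_lin p : linear (dnmul p).
Proof.
move=> k u v; rewrite /dnmul !linearP /= br_is_linear.
rewrite scale_row_mx add_row_mx; congr row_mx.
by apply/rowP => a; rewrite !mxE; ring.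
Qed.

HB.instance Definition _ p :=
  GRing.isLinear.Build R _ _ _ (dnmul p) (dnmul_lin p).

Lemma nmulE p q : nmul e p q = p + dnmul p q.
Proof. by rewrite /nmul /dnmul -[p in RHS]hsubmxK add_row_mx row_mxKl addrA. Qed.

Lemma dnmul_cont p : continuous (dnmul p).
Proof.
suff H : forall x, differentiable (dnmul p) x
  by move=> x; exact: differentiable_continuous.
move=> x.
have -> : (dnmul p : _ -> _) =
    \sum_i (fun q : 'rV[R]_(m + r) => q 0 i *: dnmul p (delta_mx 0 i)).
  apply/funext => q; rewrite fct_sumE [in LHS](row_sum_delta q) linear_sum.
  by apply: eq_bigr => i _; rewrite linearZ.
apply: differentiable_sum => i.
by apply: differentiableZl; exact: differentiable_coord.
Qed.

Lemma diff_nmul p q : 'd (nmul e p) q = dnmul p :> (_ -> _).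
Proof.
have -> : nmul e p = cst p + dnmul p by apply/funext => x; rewrite nmulE.
have d : differentiable (dnmul p) q.
  by apply: linear_differentiable; exact: dnmul_cont.
have dl : 'd (dnmul p) q = dnmul p :> ('rV[R]_(m + r) -> 'rV[R]_(m + r)).
  by apply: diff_lin; exact: dnmul_cont.
pose ev u (F : 'rV[R]_(m + r) -> 'rV[R]_(m + r)) := F u.
apply/funext => u.
have dA : 'd (dnmul p) q u = dnmul p u by apply: (congr1 (ev u) dl).
have dB : 'd (cst p) q u = 0 by apply: (congr1 (ev u) (diff_cst p q)).
apply: (etrans (congr1 (ev u) (diffD (differentiable_cst p q) d))).
apply: (etrans (congr2 +%R dB dA)).
exact: add0r.
Qed.

Lemma dnmul0 u : dnmul 0 u = u.
Proof. by rewrite /dnmul linear0 br_anti br0 oppr0 scaler0 addr0 hsubmxK. Qed.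

Lemma dnmul_inv p q u : dnmul (ninv (nmul e p q)) (dnmul p u) = dnmul (ninv q) u.
Proof.
rewrite /dnmul /ninv /nmul !row_mxKl !row_mxKr !linearN /= row_mxKl; congr row_mx.
by rewrite -addrA -scalerDr !brNl !brDl opprD addrA addrN add0r.
Qed.

Lemma nmetricE p u w :
  nmetric e p u w = ndot e (dnmul (ninv p) u) (dnmul (ninv p) w).
Proof.
have dE v : 'd (nmul e (ninv p)) p v = dnmul (ninv p) v.
  by apply: (congr1 (fun F => F v) (diff_nmul (ninv p) p)).
by apply: (congr2 (ndot e) (dE u) (dE w)).
Qed.

Lemma nmetric_left p q u w :
  nmetric e (nmul e p q) ('d (nmul e p) q u) ('d (nmul e p) q w) =
  nmetric e q u w.
Proof.
have dE v : 'd (nmul e p) q v = dnmul p v.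
  by apply: (congr1 (fun F => F v) (diff_nmul p q)).
apply: (etrans (congr2 (nmetric e _) (dE u) (dE w))).
by rewrite !nmetricE !dnmul_inv.
Qed.

Lemma nmetric1 u w : nmetric e 0 u w = ndot e u w.
Proof. by rewrite nmetricE /ninv oppr0 !dnmul0. Qed.

End Consistency.

(* The integer combinations of the rows of B, a basis of R^r. *)
Definition is_lattice (R : realType) (r : nat) (Gam : set 'rV[R]_r) : Prop :=
  exists2 B : 'M[R]_r, B \in unitmx &
    Gam = [set Z | exists c : 'rV[int]_r, Z = map_mx intr c *m B].

(* Main.v *)
(* Writing N as the matrices row_mx X Z, the left-invariant fields extending the
   coordinate vectors are the rows of the unipotent matrix
   F(X) = [[1, C(X)], [0, 1]], C(X)_(i,a) = <J_a X, e_i> / 2.  Hence the metric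
   has determinant 1 and inverse F^T F, and since the J_a are skew the (i, j)
   entry of F^T F is constant along the i-th coordinate: div grad f is simply
   sum_(i,j) (F^T F)_(i,j) d_i d_j f.  Its blocks give the Laplacians, the
   term in <J_a X, J_b X> and, by symmetry of second derivatives,
   sum_a d_a D_a.  On a function psi(X) e^(2 pi i <Zg, Z>), d_a is
   multiplication by 2 pi i Zg_a. *)
Require Import Defs.
From mathcomp Require Import all_boot all_order all_algebra.
From mathcomp Require Import all_classical all_reals all_analysis.
From mathcomp Require Import complex ring.
Import Order.TTheory GRing.Theory Num.Theory.
Import numFieldNormedType.Exports.
Set Implicit Arguments.
Unset Strict Implicit.
Local Open Scope classical_set_scope.
Local Open Scope complex_scope.
Local Open Scope ring_scope.

(** * Derivatives along lines and symmetry of second derivatives *)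

(** A directional derivative only sees the function on one line, so functions on different spaces
    can be compared. This serves both as a chain rule for affine maps and as a way to freeze factors
    that are constant along the line. *)
Lemma difference_quotient_line_eq (R : realType) (U V : normedModType R)
    (f : U -> R) (g : V -> R) (u x : U) (v y : V) :
    (forall t : R, f (t *: u + x) = g (t *: v + y)) ->
  (fun t : R => t^-1 *: ((f \o shift x) (t *: u) - f x)) =
  (fun t : R => t^-1 *: ((g \o shift y) (t *: v) - g y)).
Proof.
move=> fg; apply/funext => t /=; rewrite fg.
by have := fg 0; rewrite !scale0r !add0r => ->.
Qed.

Lemma is_derive_line_eq (R : realType) (U V : normedModType R)
    (f : U -> R) (g : V -> R) (u x : U) (v y : V) (d : R) :
    (forall t : R, f (t *: u + x) = g (t *: v + y)) ->
  is_derive y v g d -> is_derive x u f d.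
Proof.
move=> /difference_quotient_line_eq E.
by case=> dg gd; split; [rewrite /derivable E|rewrite /derive E].
Qed.

Lemma derive_line_eq (R : realType) (U V : normedModType R)
    (f : U -> R) (g : V -> R) (u x : U) (v y : V) :
    (forall t : R, f (t *: u + x) = g (t *: v + y)) ->
  'D_u f x = 'D_v g y.
Proof. by move=> /difference_quotient_line_eq E; rewrite /derive E. Qed.

(** The one-variable mean value theorem for [s |-> f (s *: v + x)] on [[0, h]]. *)
Lemma line_MVT (R : realType) (V : normedModType R) (f : V -> R) (v x : V)
    (h : R) : (forall y, differentiable f y) -> 0 < h ->
  exists2 s : R, 0 < s < h & f (h *: v + x) - f x = h * 'D_v f (s *: v + x).
Proof.
move=> df h0.
have d (s : R) : is_derive s 1 (fun s => f (s *: v + x)) ('D_v f (s *: v + x)).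
  have := @is_derive_line_eq R _ V (fun s : R => f (s *: v + x)) f 1 s v
    (s *: v + x); apply.
    by move=> t; rewrite scalerDl -scalerA scale1r addrA.
  by apply: derivableP; exact: diff_derivable.
have [|s] := @MVT R (fun s => f (s *: v + x))
  (fun s => 'D_v f (s *: v + x)) 0 h h0.
- apply: continuous_subspaceT => s; apply: differentiable_continuous.
  by apply/derivable1_diffP; case: (d s).
- rewrite in_itv /= scale0r add0r subr0 => sh ->.
  by exists s => //; rewrite mulrC.
Qed.

(** The mean value theorem is used twice: along [v] for the increment [y |-> f (h *: u + y) - f y],
    then along [u] for ['D_v f]. *)
Lemma second_difference (R : realType) (V : normedModType R) (f : V -> R)
    (u v x : V) (h : R) :
    (forall y, differentiable f y) -> (forall y, differentiable ('D_v f) y) ->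
    0 < h ->
  exists s t : R, [/\ 0 < s < h, 0 < t < h &
    f (h *: u + (h *: v + x)) - f (h *: v + x) - (f (h *: u + x) - f x) =
    h * (h * 'D_u ('D_v f) (s *: u + (t *: v + x)))].
Proof.
move=> df ddf h0.
pose fs := f \o shift (h *: u).
have dfs y : differentiable fs y.
  apply: differentiable_comp; last exact: df.
  by apply: differentiableD.
have dG y : differentiable (fs - f) y by apply: differentiableB.
have [t th Gt] := line_MVT v x dG h0.
have [s sh Fs] := line_MVT u (t *: v + x) ddf h0.
exists s, t; split => //=.
have fsE y : fs y = f (h *: u + y) by rewrite /fs /= addrC.
rewrite -!fsE -[LHS]/((fs - f) (h *: v + x) - (fs - f) x) Gt -Fs.
congr (_ * _).
rewrite deriveB; [|exact: diff_derivable..].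
(* Translation by [h *: u] commutes with moving along [v], so the derivative of the translate is the
   translate of the derivative. *)
congr (_ - _); apply: derive_line_eq => k.
by rewrite fsE addrCA.
Qed.

(* Both mixed derivatives are limits of the same second difference quotient. *)
Lemma schwarz (R : realType) (V : normedModType R) (f : V -> R) (u v x : V) :
  contdiff 2 f -> 'D_u ('D_v f) x = 'D_v ('D_u f) x.
Proof.
move=> [df c1].
have ddf w y : differentiable ('D_w f) y by have [] := c1 w.
have cont w1 w2 : continuous ('D_w1 ('D_w2 f)) by have [_] := c1 w2; exact.
apply/eqP; rewrite -subr_eq0 -normr_le0; apply/ler_addgt0Pr => e e0.
have e2 : 0 < e / 2 by rewrite divr_gt0.
have : \forall y \near x, `|'D_u ('D_v f) x - 'D_u ('D_v f) y| <= e / 2 /\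
                           `|'D_v ('D_u f) x - 'D_v ('D_u f) y| <= e / 2.
  have C1 := cont u v x; have C2 := cont v u x.
  move/cvgrPdist_le : C1 => /(_ _ e2) C1.
  move/cvgrPdist_le : C2 => /(_ _ e2) C2.
  exact: filterI C1 C2.
move=> /nbhs_normP[d /= d0 near_x].
have n0 : 0 < `|u| + `|v| + 1 by rewrite ltr_wpDl ?addr_ge0.
(* With this [h], the intermediate points of both second differences stay in the ball of radius [d];
   the [+ 1] keeps the denominator positive and the bound strict. *)
pose h := d / (`|u| + `|v| + 1).
have h0 : 0 < h by rewrite divr_gt0.
have near_p s t (w1 w2 : V) : 0 < s < h -> 0 < t < h ->
    `|w1| + `|w2| = `|u| + `|v| -> `|x - (s *: w1 + (t *: w2 + x))| < d.
  move=> /andP[s0 sh] /andP[t0 th] w12.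
  rewrite distrC addrA addrK (le_lt_trans (ler_normD _ _))// !normrZ.
  rewrite !gtr0_norm//.
  have -> : d = h * `|u| + h * `|v| + h.
    by rewrite /h -mulrDr -[X in _ + X]mulr1 -mulrDr divfK ?gt_eqF.
  rewrite -mulrDr -w12 mulrDr ltr_pwDr// lerD// ler_wpM2r// ltW//.
have [s [t [sh th E1]]] := @second_difference _ _ f u v x h df (ddf v) h0.
have [s' [t' [sh' th' E2]]] := @second_difference _ _ f v u x h df (ddf u) h0.
(* The second difference is symmetric in [u] and [v], so the two mixed derivatives take a common
   value, each at its own intermediate point; at [x] each lies within [e / 2] of it. *)
have aca (a b c k : R) : a - b - (c - k) = a - c - (b - k) by ring.
have E : 'D_u ('D_v f) (s *: u + (t *: v + x)) =
         'D_v ('D_u f) (s' *: v + (t' *: u + x)).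
  apply: (mulfI (lt0r_neq0 h0)); apply: (mulfI (lt0r_neq0 h0)).
  apply: etrans (esym E1) (etrans _ E2).
  by rewrite aca (addrCA (h *: u)).
have half (a b c : R) : `|a - c| <= e / 2 -> `|b - c| <= e / 2 -> `|a - b| <= e.
  rewrite (distrC b) => ac cb; apply: le_trans (ler_distD c a b) _.
  by have := lerD ac cb; rewrite -splitr.
have [A _] := near_x _ (near_p _ _ u v sh th erefl).
have [_ B] := near_x _ (near_p _ _ v u sh' th' (addrC _ _)).
by rewrite add0r; apply: half A _; rewrite E.
Qed.

(** * The left-invariant frame, the metric and its inverse *)

Definition bracket_mx (R : realType) (m r : nat) (e : r.-tuple 'M[R]_m)
    (X : 'rV[R]_m) : 'M[R]_(m, r) :=
  \matrix_(i, a) (2^-1 * Jact e (evec a) X 0 i).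

(* Row i holds the coordinates at (X, Z) of the left-invariant field that
   extends the i-th coordinate vector at the identity. *)
Definition frame_mx (R : realType) (m r : nat) (e : r.-tuple 'M[R]_m)
    (X : 'rV[R]_m) : 'M[R]_(m + r) :=
  block_mx 1%:M (bracket_mx e X) 0 1%:M.

Definition cometric_mx (R : realType) (m r : nat) (e : r.-tuple 'M[R]_m)
    (X : 'rV[R]_m) : 'M[R]_(m + r) :=
  (frame_mx e X)^T *m frame_mx e X.

Lemma JactDr (R : realType) (m r : nat) (e : r.-tuple 'M[R]_m) Z X Y :
  Jact e Z (X + Y) = Jact e Z X + Jact e Z Y.
Proof. exact: mulmxDl. Qed.

Lemma JactZr (R : realType) (m r : nat) (e : r.-tuple 'M[R]_m) Z t X :
  Jact e Z (t *: X) = t *: Jact e Z X.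
Proof. by rewrite /Jact -scalemxAl. Qed.

Lemma JactNr (R : realType) (m r : nat) (e : r.-tuple 'M[R]_m) Z X :
  Jact e Z (- X) = - Jact e Z X.
Proof. by rewrite /Jact mulNmx. Qed.

Lemma bracket_mxij (R : realType) (m r : nat) (e : r.-tuple 'M[R]_m) X i a :
  bracket_mx e X i a = 2^-1 * Jact e (evec a) X 0 i.
Proof. by rewrite [LHS]mxE. Qed.

Lemma bracket_mxN (R : realType) (m r : nat) (e : r.-tuple 'M[R]_m) X :
  bracket_mx e (- X) = - bracket_mx e X.
Proof. apply/matrixP => i a; rewrite [RHS]mxE !bracket_mxij JactNr.
by rewrite [X in _ * X]mxE mulrN. Qed.

Lemma mul_bracket_mx (R : realType) (m r : nat) (e : r.-tuple 'M[R]_m) X Y :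
  Y *m bracket_mx e X = 2^-1 *: br e X Y.
Proof.
apply/rowP => a; rewrite [LHS]mxE [RHS]mxE [br _ _ _ _ _]mxE mulr_sumr.
apply: eq_bigr => i _; rewrite bracket_mxij.
by rewrite mulrCA [Y 0 i * _]mulrC.
Qed.

(** The frame is unipotent with an off-diagonal block that is odd in [X], so changing the sign of
    [X] inverts it. *)
Lemma mul_frame_mxN (R : realType) (m r : nat) (e : r.-tuple 'M[R]_m) X :
  frame_mx e X *m frame_mx e (- X) = 1%:M.
Proof.
rewrite /frame_mx mulmx_block !mul1mx !mulmx0 !mul0mx !mulmx1 bracket_mxN.
by rewrite !addr0 add0r addNr -scalar_mx_block.
Qed.

Lemma dnmulE (R : realType) (m r : nat) (e : r.-tuple 'M[R]_m) p u :
  dnmul e p u = u *m frame_mx e (lsubmx p).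
Proof.
rewrite /dnmul /frame_mx -[u in RHS]hsubmxK mul_row_block mulmx0 !mulmx1 addr0.
by rewrite mul_bracket_mx addrC.
Qed.

(** Tangent vectors at [p] are brought to the identity by [dnmul (ninv p)], which is right
    multiplication by the frame at [- lsubmx p]; there [ndot] is the standard dot product because
    [e] is orthonormal. *)
Lemma gramE (R : realType) (m r : nat) (e : r.-tuple 'M[R]_m) p
    (e_on : forall a b : 'I_r, - \tr (tnth e a *m tnth e b) = (a == b)%:R)
    (e_skew : forall a : 'I_r, (tnth e a)^T = - tnth e a) :
  gram (nmetric e) p =
    frame_mx e (- lsubmx p) *m (frame_mx e (- lsubmx p))^T.
Proof.
have ndotE u w : ndot e u w = (u *m w^T) 0 0.
  rewrite /ndot zdotE// !dotE -[u in RHS]hsubmxK -[w in RHS]hsubmxK.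
  by rewrite tr_row_mx mul_row_col [RHS]mxE.
apply/matrixP => i j; rewrite mxE nmetricE// ndotE !dnmulE /ninv linearN /=.
by rewrite -!rowE !mxE; apply: eq_bigr => k _; rewrite !mxE.
Qed.

Lemma vol_density1 (R : realType) (m r : nat) (e : r.-tuple 'M[R]_m) p
    (e_on : forall a b : 'I_r, - \tr (tnth e a *m tnth e b) = (a == b)%:R)
    (e_skew : forall a : 'I_r, (tnth e a)^T = - tnth e a) :
  vol_density (nmetric e) p = 1.
Proof.
by rewrite /vol_density gramE// det_mulmx det_tr det_ublock !det1 !mulr1 sqrtr1.
Qed.

(** With F the frame, the product of F(-X) F(-X)^T and F(X)^T F(X) telescopes, since F(X) and F(-X)
    are inverse to each other. *)
Lemma invmx_gram (R : realType) (m r : nat) (e : r.-tuple 'M[R]_m) p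
    (e_on : forall a b : 'I_r, - \tr (tnth e a *m tnth e b) = (a == b)%:R)
    (e_skew : forall a : 'I_r, (tnth e a)^T = - tnth e a) :
  invmx (gram (nmetric e) p) = cometric_mx e (lsubmx p).
Proof.
set X := lsubmx p.
have FNF : frame_mx e (- X) *m frame_mx e X = 1%:M.
  by have := mul_frame_mxN e (- X); rewrite opprK.
have GH : gram (nmetric e) p *m cometric_mx e X = 1%:M.
  rewrite gramE// -/X mulmxA -(mulmxA (frame_mx e (- X))) -trmx_mul.
  by rewrite mul_frame_mxN trmx1 mulmx1.
have [U _] := mulmx1_unit GH.
by rewrite -[LHS]mulmx1 -GH mulmxA mulVmx// mul1mx.
Qed.

Lemma cometric_mxE (R : realType) (m r : nat) (e : r.-tuple 'M[R]_m) X :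
  cometric_mx e X =
    block_mx 1%:M (bracket_mx e X) (bracket_mx e X)^T
             ((bracket_mx e X)^T *m bracket_mx e X + 1%:M).
Proof.
rewrite /cometric_mx /frame_mx tr_block_mx mulmx_block !trmx1 trmx0.
by rewrite !mul1mx !mulmx1 !mulmx0 !addr0.
Qed.

(* The (i, j) coefficient does not vary along the i-th coordinate direction, so
   the Laplacian has no first-order part. *)
Lemma cometric_mx_line (R : realType) (m r : nat) (e : r.-tuple 'M[R]_m)
    (e_skew : forall a : 'I_r, (tnth e a)^T = - tnth e a)
    (p : 'rV[R]_(m + r)) (i j : 'I_(m + r)) (t : R) :
  cometric_mx e (lsubmx (t *: delta_mx 0 i + p)) i j =
  cometric_mx e (lsubmx p) i j.
Proof.
(* Moving in a central direction leaves [lsubmx p], hence the whole matrix, unchanged. *)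
case: (split_ordP i) => k -> {i}; last first.
  congr (cometric_mx e _ _ _); apply/rowP => l.
  by rewrite !mxE eqxx eq_lrshift mulr0 add0r.
rewrite !cometric_mxE.
case: (split_ordP j) => l -> {j}; first by rewrite !block_mxEul.
rewrite !block_mxEur !bracket_mxij; congr (_ * _).
rewrite (_ : lsubmx _ = t *: delta_mx 0 k + lsubmx p); last first.
  by apply/rowP => i; rewrite !mxE (inj_eq (@lshift_inj m r)).
rewrite JactDr JactZr [LHS]mxE [X in X + _]mxE /Jact Jmx_evec -rowE.
(* Along the k-th direction of v, the mixed entry changes by a multiple of the k-th diagonal entry
   of the skew matrix [tnth e l], which is zero. *)
have /matrixP/(_ k k) := e_skew l; rewrite mxE [RHS]mxE => /eqP.
rewrite -addr_eq0 -mulr2n mulrn_eq0 /= => /eqP ekk.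
by rewrite [row k _ _ _]mxE ekk mulr0 add0r.
Qed.

(** * Calculus of complex-valued functions of real variables *)

Definition cdifferentiable (R : realType) (V : normedModType R)
    (f : V -> R[i]) : Prop :=
  forall x, differentiable (fun y => complex.Re (f y)) x /\
            differentiable (fun y => complex.Im (f y)) x.

Lemma csmooth_cdifferentiable (R : realType) (V : normedModType R)
  (f : V -> R[i]) : csmooth f -> cdifferentiable f.
Proof. by move=> [/(_ 1%N)[fr _] /(_ 1%N)[fi _]] x. Qed.

Lemma smooth_derive (R : realType) (V : normedModType R) (f : V -> R) (v : V) :
  smooth f -> smooth ('D_v f).
Proof. by move=> fs k; have [_] := fs k.+1; exact. Qed.

Lemma csmooth_cderive (R : realType) (V : normedModType R) (f : V -> R[i])
  (v : V) : csmooth f -> csmooth (cderive v f).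
Proof. by move=> [fr fi]; split; exact: smooth_derive. Qed.

Lemma cderive_line_eq (R : realType) (U V : normedModType R)
    (f : U -> R[i]) (g : V -> R[i]) (u x : U) (v y : V) :
    (forall t : R, f (t *: u + x) = g (t *: v + y)) ->
  cderive u f x = cderive v g y.
Proof.
by move=> fg; congr (_ +i* _); apply: derive_line_eq => t; rewrite fg.
Qed.

(** Since [cderive] acts on real and imaginary parts separately, linearity over [R[i]] has to be
    checked on the two real combinations of these parts. *)
Lemma cderiveZ (R : realType) (V : normedModType R) (f : V -> R[i])
    (k : R[i]) (v x : V) : cdifferentiable f ->
  cderive v (fun y => k * f y) x = k * cderive v f x.
Proof.
case: k => a b df; have [] := df x.
rewrite /cderive; set fr := fun y => complex.Re (f y).
set fi := fun y => complex.Im (f y) => dr di.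
have Dr : derivable fr x v by exact: diff_derivable.
have Di : derivable fi x v by exact: diff_derivable.
have -> : (fun y => complex.Re ((a +i* b) * f y)) = a \*: fr - b \*: fi.
  apply/funext => y; rewrite -[RHS]/(a * complex.Re (f y) - b * complex.Im (f y)).
  by case: (f y).
have -> : (fun y => complex.Im ((a +i* b) * f y)) = a \*: fi + b \*: fr.
  apply/funext => y; rewrite -[RHS]/(a * complex.Im (f y) + b * complex.Re (f y)).
  by case: (f y).
rewrite deriveB; [|exact: derivableZ|exact: derivableZ].
rewrite deriveD; [|exact: derivableZ|exact: derivableZ].
rewrite (deriveZ a Dr) (deriveZ b Di) (deriveZ a Di) (deriveZ b Dr).
by [].
Qed.

(** For a differentiable function the directional derivative is the value of the differential, which
    is linear in the direction. *)
Lemma derive_sum_dir (R : realType) (V : normedModType R) (f : V -> R)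
    (n : nat) (c : 'I_n -> R) (v : 'I_n -> V) (x : V) : differentiable f x ->
  'D_(\sum_i c i *: v i) f x = \sum_i c i * 'D_(v i) f x.
Proof.
move=> df; rewrite deriveE// linear_sum; apply: eq_bigr => i _.
by rewrite deriveE// linearZ.
Qed.

Lemma sum_complex (R : rcfType) (n : nat) (a b : 'I_n -> R) :
  \sum_i (a i +i* b i) = (\sum_i a i) +i* (\sum_i b i).
Proof.
by elim/big_rec3 : _ => // i _ ? ? _ -> //.
Qed.

Lemma cderive_sum_dir (R : realType) (V : normedModType R) (f : V -> R[i])
    (n : nat) (c : 'I_n -> R) (v : 'I_n -> V) (x : V) : cdifferentiable f ->
  cderive (\sum_i c i *: v i) f x = \sum_i (c i)%:C * cderive (v i) f x.
Proof.
move=> df; have [dr di] := df x.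
rewrite /cderive !derive_sum_dir// -sum_complex; apply: eq_bigr => i _.
by apply/eqP; rewrite eq_complex /= !mul0r subr0 addr0 !eqxx.
Qed.

Lemma cderiveC (R : realType) (V : normedModType R) (f : V -> R[i])
    (u v x : V) : csmooth f ->
  cderive u (cderive v f) x = cderive v (cderive u f) x.
Proof.
move=> [/(_ 2%N) sr /(_ 2%N) si].
set fr := (fun y => complex.Re (f y)) in sr.
set fi := (fun y => complex.Im (f y)) in si.
rewrite -[LHS]/('D_u ('D_v fr) x +i* 'D_u ('D_v fi) x).
by rewrite (schwarz u v x sr) (schwarz u v x si).
Qed.

(** * The Laplacian in coordinates *)

(** The density is 1, and by [cometric_mx_line] each coefficient passes through the outer
    derivative. *)
Lemma nlaplacian_cometric (R : realType) (m r : nat) (e : r.-tuple 'M[R]_m)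
    (f : 'rV[R]_(m + r) -> R[i]) (p : 'rV[R]_(m + r))
    (e_on : forall a b : 'I_r, - \tr (tnth e a *m tnth e b) = (a == b)%:R)
    (e_skew : forall a : 'I_r, (tnth e a)^T = - tnth e a) :
    csmooth f ->
  nlaplacian e f p = \sum_i \sum_j (cometric_mx e (lsubmx p) i j)%:C *
    cderive (delta_mx 0 i) (cderive (delta_mx 0 j) f) p.
Proof.
move=> fs; rewrite /nlaplacian /laplace_beltrami vol_density1// invr1 mul1r.
apply: eq_bigr => i _; apply: eq_bigr => j _.
(* The coefficient at [p] is moved inside as a constant; the two functions to differentiate then
   agree on the i-th coordinate line through [p]. *)
rewrite -cderiveZ; last exact/csmooth_cdifferentiable/csmooth_cderive.
apply: cderive_line_eq => t.
by rewrite vol_density1// invmx_gram// mul1r cometric_mx_line.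
Qed.

Lemma delta_lshift (R : realType) (m r : nat) (i : 'I_m) :
  delta_mx 0 (lshift r i) = vdir r (delta_mx 0 i : 'rV[R]_m).
Proof.
rewrite /vdir -[LHS]hsubmxK; congr row_mx; apply/rowP => j; rewrite !mxE eqxx.
  by rewrite (inj_eq (@lshift_inj m r)).
by rewrite eq_rlshift.
Qed.

Lemma delta_rshift (R : realType) (m r : nat) (a : 'I_r) :
  delta_mx 0 (rshift m a) = zdir m (evec a : 'rV[R]_r).
Proof.
rewrite /zdir -[LHS]hsubmxK; congr row_mx; apply/rowP => j; rewrite !mxE eqxx.
  by rewrite eq_lrshift.
by rewrite (inj_eq (@rshift_inj m r)).
Qed.

Lemma lsubmx_line_zdir (R : realType) (m r : nat) (t : R) (Z : 'rV[R]_r)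
    (p : 'rV[R]_(m + r)) : lsubmx (t *: zdir m Z + p) = lsubmx p.
Proof.
by rewrite /zdir linearD linearZ /= row_mxKl scaler0 add0r.
Qed.

Lemma lsubmx_line_vdir (R : realType) (m r : nat) (t : R) (X : 'rV[R]_m)
    (p : 'rV[R]_(m + r)) : lsubmx (t *: vdir r X + p) = t *: X + lsubmx p.
Proof. by rewrite /vdir linearD linearZ /= row_mxKl. Qed.

Lemma rsubmx_line_vdir (R : realType) (m r : nat) (t : R) (X : 'rV[R]_m)
    (p : 'rV[R]_(m + r)) : rsubmx (t *: vdir r X + p) = rsubmx p.
Proof. by rewrite /vdir linearD linearZ /= row_mxKr scaler0 add0r. Qed.

Lemma cderive_vdir (R : realType) (m r : nat) (f : 'rV[R]_(m + r) -> R[i])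
    (X : 'rV[R]_m) (p : 'rV[R]_(m + r)) : cdifferentiable f ->
  cderive (vdir r X) f p =
    \sum_i (X 0 i)%:C * cderive (vdir r (delta_mx 0 i)) f p.
Proof.
move=> df; rewrite -(cderive_sum_dir (fun i => X 0 i) _ _ df).
congr (cderive _ f p); rewrite {1}(row_sum_delta X) /vdir.
rewrite -[RHS]hsubmxK !linear_sum; congr row_mx.
  by apply: eq_bigr => i _; rewrite linearZ /= row_mxKl.
by rewrite big1// => i _; rewrite linearZ /= row_mxKr scaler0.
Qed.

Lemma cderive_row (R : realType) (m : nat) (f : 'rV[R]_m -> R[i])
    (X p : 'rV[R]_m) : cdifferentiable f ->
  cderive X f p = \sum_i (X 0 i)%:C * cderive (delta_mx 0 i) f p.
Proof.
move=> df; rewrite -(cderive_sum_dir (fun i => X 0 i) _ _ df).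
by rewrite -row_sum_delta.
Qed.

(** The vector J_a(X) is constant along central lines, so it can be frozen at [p]. Symmetry of
    second derivatives then exchanges the two derivations, and linearity in the direction gives the
    sum. *)
Lemma dz_Dv (R : realType) (m r : nat) (e : r.-tuple 'M[R]_m) (a : 'I_r)
    (f : 'rV[R]_(m + r) -> R[i]) (p : 'rV[R]_(m + r)) : csmooth f ->
  dz a (Dv e a f) p = \sum_i (Jact e (evec a) (lsubmx p) 0 i)%:C *
    cderive (vdir r (delta_mx 0 i)) (dz a f) p.
Proof.
move=> fs; rewrite -cderive_vdir; last first.
  exact/csmooth_cdifferentiable/csmooth_cderive.
rewrite {2}/dz (cderiveC (vdir r _) (zdir m (evec a)) p fs).
apply: cderive_line_eq => t.
by rewrite /Dv /cderive_field lsubmx_line_zdir.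
Qed.

(** The block expansion is pure algebra, so the second derivatives are replaced by an arbitrary
    array [D]. As [D] need not be symmetric, both mixed terms are kept. *)
Lemma sum_cometric_mx (R : realType) (m r : nat) (e : r.-tuple 'M[R]_m)
    (X : 'rV[R]_m) (D : 'I_(m + r) -> 'I_(m + r) -> R[i]) :
  \sum_i \sum_j (cometric_mx e X i j)%:C * D i j =
    \sum_i D (lshift r i) (lshift r i) + \sum_a D (rshift m a) (rshift m a)
    + (4^-1)%:C * (\sum_a \sum_b
        (dot (Jact e (evec a) X) (Jact e (evec b) X))%:C *
          D (rshift m a) (rshift m b))
    + \sum_a \sum_i (2^-1 * Jact e (evec a) X 0 i)%:C *
        (D (lshift r i) (rshift m a) + D (rshift m a) (lshift r i)).
Proof.
have delta_sum n (i : 'I_n) (F : 'I_n -> R[i]) :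
    \sum_j ((1%:M : 'M[R]_n) i j)%:C * F j = F i.
  rewrite (bigD1 i)//= big1 ?addr0 => [|j ji]; first by rewrite mxE eqxx mul1r.
  by rewrite mxE eq_sym (negbTE ji) mul0r.
rewrite cometric_mxE; set C := bracket_mx e X.
have EV i : \sum_j (block_mx 1%:M C C^T (C^T *m C + 1%:M) (lshift r i) j)%:C *
      D (lshift r i) j =
    D (lshift r i) (lshift r i) + \sum_a (C i a)%:C * D (lshift r i) (rshift m a).
  rewrite big_split_ord /=.
  rewrite -[X in _ = X + _](delta_sum _ i (fun j => D (lshift r i) (lshift r j))).
  congr (_ + _); apply: eq_bigr => j _; first by rewrite block_mxEul.
  by rewrite block_mxEur.
have EZ a : \sum_j (block_mx 1%:M C C^T (C^T *m C + 1%:M) (rshift m a) j)%:C *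
      D (rshift m a) j =
    \sum_i (C i a)%:C * D (rshift m a) (lshift r i) +
    (\sum_b ((C^T *m C) a b)%:C * D (rshift m a) (rshift m b)
     + D (rshift m a) (rshift m a)).
  rewrite big_split_ord /=.
  rewrite -[X in _ = _ + (_ + X)](delta_sum _ a
    (fun j => D (rshift m a) (rshift m j))).
  rewrite -big_split /=; congr (_ + _); apply: eq_bigr => b _.
    by rewrite block_mxEdl [in LHS]mxE.
  by rewrite block_mxEdr [in LHS]mxE rmorphD mulrDl.
rewrite big_split_ord /= (eq_bigr _ (fun i _ => EV i)) (eq_bigr _ (fun a _ => EZ a)).
rewrite !big_split /= [X in _ + X + _]exchange_big /=.
(* Each factor of [C^T *m C] carries one half, whence the coefficient 1/4. *)
have -> : \sum_a \sum_b ((C^T *m C) a b)%:C * D (rshift m a) (rshift m b) =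
   (4^-1)%:C * (\sum_a \sum_b
        (dot (Jact e (evec a) X) (Jact e (evec b) X))%:C *
          D (rshift m a) (rshift m b)).
  rewrite mulr_sumr; apply: eq_bigr => a _.
  rewrite mulr_sumr; apply: eq_bigr => b _.
  rewrite mulrA -rmorphM; congr (_%:C * _).
  rewrite mxE mulr_sumr; apply: eq_bigr => i _.
  by rewrite [in LHS]mxE !bracket_mxij; field.
have -> : \sum_a \sum_i (2^-1 * Jact e (evec a) X 0 i)%:C *
        (D (lshift r i) (rshift m a) + D (rshift m a) (lshift r i)) =
   \sum_a \sum_i (C i a)%:C * D (lshift r i) (rshift m a) +
   \sum_a \sum_i (C i a)%:C * D (rshift m a) (lshift r i).
  rewrite -big_split; apply: eq_bigr => a _; rewrite -big_split.
  by apply: eq_bigr => i _; rewrite bracket_mxij mulrDr.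
move: (\sum_a _) (\sum_a _) (\sum_a _) (\sum_a _) (_ * _) => a b c d k.
ring.
Qed.

(** Merges the two mixed blocks, each of which contributes half of the first-order central term. *)
Lemma half_mulD (R : realType) (c : R) (z : R[i]) :
  (2^-1 * c)%:C * (z + z) = c%:C * z.
Proof.
rewrite -mulr2n mulrnAr -mulrnAl -(rmorphMn (real_complex R)) /=.
by congr (_%:C * _); rewrite -mulr_natr; field.
Qed.

Lemma nlaplacianE (R : realType) (m r : nat) (e : r.-tuple 'M[R]_m)
    (f : 'rV[R]_(m + r) -> R[i]) (p : 'rV[R]_(m + r))
    (e_on : forall a b : 'I_r, - \tr (tnth e a *m tnth e b) = (a == b)%:R)
    (e_skew : forall a : 'I_r, (tnth e a)^T = - tnth e a) :
    csmooth f ->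
  nlaplacian e f p =
    lap_v f p + lap_z f p
    + (4^-1)%:C * (\sum_(a < r) \sum_(b < r)
        (dot (Jact e (evec a) (lsubmx p))
             (Jact e (evec b) (lsubmx p)))%:C * dz a (dz b f) p)
    + \sum_(a < r) dz a (Dv e a f) p.
Proof.
move=> fs; rewrite nlaplacian_cometric// sum_cometric_mx.
have Hl : \sum_i cderive (delta_mx 0 (lshift r i))
    (cderive (delta_mx 0 (lshift r i)) f) p = lap_v f p.
  by apply: eq_bigr => i _; rewrite delta_lshift.
have Hr : \sum_a cderive (delta_mx 0 (rshift m a))
    (cderive (delta_mx 0 (rshift m a)) f) p = lap_z f p.
  by apply: eq_bigr => a _; rewrite delta_rshift.
apply: (congr2 +%R (congr2 +%R (congr2 +%R Hl Hr) (congr1 ( *%R _) _)) _).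
  by apply: eq_bigr => a _; apply: eq_bigr => b _; rewrite !delta_rshift.
apply: eq_bigr => a _; rewrite (dz_Dv e a p fs); apply: eq_bigr => i _.
rewrite delta_lshift delta_rshift.
rewrite (cderiveC (zdir m (evec a)) (vdir r (delta_mx 0 i)) p fs).
exact: half_mulD.
Qed.

(** * Closure properties of smooth functions *)

(** Needed for products: in the Leibniz rule the undifferentiated factors must have the same class
    as the differentiated ones. *)
Lemma contdiffW (R : realType) (V : normedModType R) k (f : V -> R) :
  contdiff k.+1 f -> contdiff k f.
Proof.
elim: k f => [|k IH] f [df cf].
  by move=> x; exact: differentiable_continuous.
by split=> // v; apply: IH; exact: cf.
Qed.

Lemma contdiff_cst (R : realType) (V : normedModType R) k (c : R) :
  contdiff k (cst c : V -> R).
Proof.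
elim: k c => [|k IH] c; first by move=> x; exact: cst_continuous.
split=> [x|v]; first exact: differentiable_cst.
have -> : 'D_v (cst c : V -> R) = cst 0 by apply/funext => x; exact: derive_cst.
exact: IH.
Qed.

Lemma contdiffD (R : realType) (V : normedModType R) k (f g : V -> R) :
  contdiff k f -> contdiff k g -> contdiff k (f + g).
Proof.
elim: k f g => [|k IH] f g.
  by move=> cf cg x; apply: continuousD; [exact: cf|exact: cg].
move=> [df cf] [dg cg]; split=> [x|v]; first exact: differentiableD.
have -> : 'D_v (f + g) = 'D_v f + 'D_v g.
  by apply/funext => x; apply: deriveD; exact: diff_derivable.
by apply: IH; [exact: cf|exact: cg].
Qed.

Lemma contdiffM (R : realType) (V : normedModType R) k (f g : V -> R) :
  contdiff k f -> contdiff k g -> contdiff k (f * g).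
Proof.
elim: k f g => [|k IH] f g.
  by move=> cf cg x; apply: continuousM; [exact: cf|exact: cg].
move=> cf1 cg1; have cf := contdiffW cf1; have cg := contdiffW cg1.
case: cf1 cg1 => df cf1 [dg cg1]; split=> [x|v]; first exact: differentiableM.
have -> : 'D_v (f * g) = f * 'D_v g + g * 'D_v f.
  by apply/funext => x; apply: deriveM; exact: diff_derivable.
by apply: contdiffD; apply: IH => //; [exact: cg1|exact: cf1].
Qed.

(** The derivative of [f \o L] along [v] is again a composition with the same [L], namely of
    ['D_(L v) f], so the induction runs over all [f] with [L] fixed. *)
Lemma contdiff_comp_linear (R : realType) (U V : normedModType R) k
    (L : U -> V) (f : V -> R) :
    (forall x, differentiable L x) ->
    (forall t u x, L (t *: u + x) = t *: L u + L x) ->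
  contdiff k f -> contdiff k (f \o L).
Proof.
move=> dL lL; elim: k f => [|k IH] f.
  move=> cf x; apply: continuous_comp; last exact: cf.
  exact: differentiable_continuous.
move=> [df cf]; split=> [x|v]; first by apply: differentiable_comp.
have -> : 'D_v (f \o L) = 'D_(L v) f \o L.
  by apply/funext => x; apply: derive_line_eq => t; rewrite /= lL.
by apply: IH; exact: cf.
Qed.

Lemma smooth_linear (R : realType) (V : normedModType R) (L : V -> R) :
    (forall x, differentiable L x) ->
    (forall t u x, L (t *: u + x) = t * L u + L x) -> smooth L.
Proof.
move=> dL lL [|k]; first by move=> x; exact: differentiable_continuous.
split=> // v; have -> : 'D_v L = cst (L v); last exact: contdiff_cst.
(* On a line in direction [v], [L] agrees with the identity of [R] on the line through [L x] with
   direction [L v]. *)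
apply/funext => x; rewrite -[RHS](derive_id (L x) (L v)).
by apply: derive_line_eq => t; rewrite lL.
Qed.

Lemma derive_realdir (R : realType) (f : R -> R) (v x : R) :
  derivable f x 1 -> 'D_v f x = v * 'D_1 f x.
Proof.
move=> /derivable1_diffP df; rewrite !deriveE//.
by rewrite -[in LHS](mulr1 v) [LHS]linearZ.
Qed.

(** A simultaneous induction, as each function is up to a constant factor the derivative of the
    other; the factor includes the direction [v], which is itself a number. *)
Lemma smooth_cos_sin (R : realType) : smooth (@cos R) /\ smooth (@sin R).
Proof.
have dc x : derivable (@cos R) x 1 by exact: derivable_cos.
have ds x : derivable (@sin R) x 1 by exact: derivable_sin.
have H k : contdiff k (@cos R) /\ contdiff k (@sin R).
  elim: k => [|k [IHc IHs]].
    by split; [exact: continuous_cos|exact: continuous_sin].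
  split; split=> [x|v]; [exact/derivable1_diffP| |exact/derivable1_diffP|].
    have -> : 'D_v (@cos R) = cst (- v) * @sin R.
      apply/funext => x; rewrite derive_realdir// derive_val.
      by rewrite -[RHS]/(- v * sin x) mulrN mulNr.
    by apply: contdiffM => //; exact: contdiff_cst.
  have -> : 'D_v (@sin R) = cst v * @cos R.
    by apply/funext => x; rewrite derive_realdir// derive_val.
  by apply: contdiffM => //; exact: contdiff_cst.
by split=> k; case: (H k).
Qed.

Lemma smoothD (R : realType) (V : normedModType R) (f g : V -> R) :
  smooth f -> smooth g -> smooth (fun x => f x + g x).
Proof. by move=> fs gs k; exact: contdiffD. Qed.

Lemma smoothM (R : realType) (V : normedModType R) (f g : V -> R) :
  smooth f -> smooth g -> smooth (fun x => f x * g x).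
Proof. by move=> fs gs k; exact: contdiffM. Qed.

Lemma smooth_cst (R : realType) (V : normedModType R) (c : R) :
  smooth (fun _ : V => c).
Proof. by move=> k; exact: contdiff_cst. Qed.

Lemma smooth_sum (R : realType) (V : normedModType R) (n : nat)
    (f : 'I_n -> V -> R) : (forall i, smooth (f i)) ->
  smooth (fun x => \sum_i f i x).
Proof.
move=> fs; rewrite -fct_sumE; elim/big_ind : _ => //.
  exact: smooth_cst.
by move=> g h; exact: smoothD.
Qed.

Lemma smooth_coord (R : realType) (n : nat) (i : 'I_n) :
  smooth (fun X : 'rV[R]_n => X 0 i).
Proof.
apply: smooth_linear => [x|t u x]; first exact: differentiable_coord.
by rewrite !mxE.
Qed.

Lemma csmooth_real (R : realType) (V : normedModType R) (f : V -> R) :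
  smooth f -> csmooth (fun x => (f x)%:C).
Proof. by move=> fs; split=> //=; exact: smooth_cst. Qed.

Lemma csmoothD (R : realType) (V : normedModType R) (f g : V -> R[i]) :
  csmooth f -> csmooth g -> csmooth (fun x => f x + g x).
Proof.
move=> [fr fi] [gr gi]; split.
  rewrite (_ : (fun x => complex.Re (f x + g x)) =
    (fun x => complex.Re (f x) + complex.Re (g x))); first exact: smoothD.
  by apply/funext => x; case: (f x) (g x) => [? ?] [].
rewrite (_ : (fun x => complex.Im (f x + g x)) =
  (fun x => complex.Im (f x) + complex.Im (g x))); first exact: smoothD.
by apply/funext => x; case: (f x) (g x) => [? ?] [].
Qed.

Lemma csmoothM (R : realType) (V : normedModType R) (f g : V -> R[i]) :
  csmooth f -> csmooth g -> csmooth (fun x => f x * g x).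
Proof.
move=> [fr fi] [gr gi]; split.
  rewrite (_ : (fun x => complex.Re (f x * g x)) =
    (fun x => complex.Re (f x) * complex.Re (g x) +
              -1 * (complex.Im (f x) * complex.Im (g x)))).
    by apply: smoothD; [|apply: smoothM; [exact: smooth_cst|]]; exact: smoothM.
  by apply/funext => x; case: (f x) (g x) => [? ?] [] *; rewrite mulN1r.
rewrite (_ : (fun x => complex.Im (f x * g x)) =
  (fun x => complex.Re (f x) * complex.Im (g x) +
            complex.Im (f x) * complex.Re (g x))).
  by apply: smoothD; exact: smoothM.
by apply/funext => x; case: (f x) (g x) => [? ?] [].
Qed.

Lemma csmooth_cst (R : realType) (V : normedModType R) (c : R[i]) :
  csmooth (fun _ : V => c).
Proof. by split; exact: smooth_cst. Qed.

Lemma csmooth_sum (R : realType) (V : normedModType R) (n : nat)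
    (f : 'I_n -> V -> R[i]) : (forall i, csmooth (f i)) ->
  csmooth (fun x => \sum_i f i x).
Proof.
move=> fs; rewrite -fct_sumE; elim/big_ind : _ => //.
  exact: csmooth_cst.
by move=> g h; exact: csmoothD.
Qed.

(** * Smoothness of the operator's output and of the Fourier modes *)

Lemma JactDl (R : realType) (m r : nat) (e : r.-tuple 'M[R]_m) Z X :
  Jact e Z X = \sum_a Z 0 a *: Jact e (evec a) X.
Proof.
rewrite /Jact /Jmx (@mulmx_sumr R 1 m m); apply: eq_bigr => a _.
by rewrite -/(Jmx e (evec a)) Jmx_evec -scalemxAr.
Qed.

Lemma smooth_Jact (R : realType) (m r : nat) (e : r.-tuple 'M[R]_m) Z i :
  smooth (fun X => Jact e Z X 0 i).
Proof.
have -> : (fun X => Jact e Z X 0 i) = (fun X => \sum_j X 0 j * Jmx e Z j i).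
  by apply/funext => X; rewrite /Jact mxE.
by apply: smooth_sum => j; apply: smoothM; [exact: smooth_coord|exact: smooth_cst].
Qed.

(** The direction varies with the point, so the derivative is expanded into fixed coordinate
    directions with coefficients linear in [X]. *)
Lemma csmooth_cderive_field_Jact (R : realType) (m r : nat)
    (e : r.-tuple 'M[R]_m) Z (psi : 'rV[R]_m -> R[i]) : csmooth psi ->
  csmooth (cderive_field (Jact e Z) psi).
Proof.
move=> ps.
have -> : cderive_field (Jact e Z) psi =
    (fun X => \sum_i (Jact e Z X 0 i)%:C * cderive (delta_mx 0 i) psi X).
  apply/funext => X; apply: cderive_row; exact: csmooth_cdifferentiable.
apply: csmooth_sum => i; apply: csmoothM; last exact: csmooth_cderive.
by apply: csmooth_real; exact: smooth_Jact.
Qed.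

(** Membership in [mode_space] asks for a smooth profile, so the invariance rests on this fact. *)
Lemma csmooth_box (R : realType) (m r : nat) (e : r.-tuple 'M[R]_m) Zg
    (psi : 'rV[R]_m -> R[i]) : csmooth psi -> csmooth (box e Zg psi).
Proof.
move=> ps.
have -> : box e Zg psi = (fun X => lapX psi X
    + (2 * pi)%:C * 'i%C * cderive_field (Jact e Zg) psi X
    + (- (4 * pi ^+ 2) * (zdot e Zg Zg
         + 4^-1 * \sum_i Jact e Zg X 0 i * Jact e Zg X 0 i))%:C * psi X).
  by apply/funext => X; rewrite /box mulNr rmorphN mulNr.
apply: csmoothD; first apply: csmoothD.
- by apply: csmooth_sum => i; do 2 apply: csmooth_cderive.
- by apply: csmoothM; [exact: csmooth_cst|exact: csmooth_cderive_field_Jact].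
- apply: csmoothM => //; apply: csmooth_real.
  apply: smoothM; first exact: smooth_cst.
  apply: smoothD; first exact: smooth_cst.
  apply: smoothM; first exact: smooth_cst.
  by apply: smooth_sum => i; apply: smoothM; exact: smooth_Jact.
Qed.

Lemma csmooth_cexpi (R : realType) : csmooth (@cexpi R).
Proof. by have [c s] := smooth_cos_sin R; split. Qed.

Lemma cderive_cexpi (R : realType) (v x : R) :
  cderive v (@cexpi R) x = v%:C * 'i%C * cexpi x.
Proof.
rewrite /cderive /cexpi /= (@derive_realdir _ (@cos R)); last first.
  exact: derivable_cos.
rewrite (@derive_realdir _ (@sin R)); last first.
  exact: derivable_sin.
rewrite !derive_val.
by apply/eqP; rewrite eq_complex /=; apply/andP; split; apply/eqP; ring.
Qed.

(** Isolating this linear form presents a mode as a product of two compositions with linear maps. *)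
Definition phase (R : realType) (m r : nat) (e : r.-tuple 'M[R]_m)
    (Zg : 'rV[R]_r) (p : 'rV[R]_(m + r)) : R := 2 * pi * zdot e Zg (rsubmx p).

Lemma phase_linear (R : realType) (m r : nat) (e : r.-tuple 'M[R]_m)
    (e_on : forall a b : 'I_r, - \tr (tnth e a *m tnth e b) = (a == b)%:R)
    (Zg : 'rV[R]_r) t u x :
  phase e Zg (t *: u + x) = t * phase e Zg u + phase e Zg x.
Proof.
rewrite /phase !zdotE// linearP /= !dotE linearP /= mulmxDr -scalemxAr !mxE.
ring.
Qed.

Lemma smooth_phase (R : realType) (m r : nat) (e : r.-tuple 'M[R]_m)
    (e_on : forall a b : 'I_r, - \tr (tnth e a *m tnth e b) = (a == b)%:R)
    (Zg : 'rV[R]_r) : smooth (phase e Zg).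
Proof.
have -> : phase e Zg = (fun p => 2 * pi * \sum_a Zg 0 a * p 0 (rshift m a)).
  apply/funext => p; rewrite /phase zdotE//; congr (_ * _).
  by apply: eq_bigr => a _; rewrite mxE.
apply: smoothM; first exact: smooth_cst.
by apply: smooth_sum => a; apply: smoothM; [exact: smooth_cst|exact: smooth_coord].
Qed.

Lemma csmooth_comp_linear (R : realType) (U V : normedModType R)
    (L : U -> V) (f : V -> R[i]) :
    (forall x, differentiable L x) ->
    (forall t u x, L (t *: u + x) = t *: L u + L x) ->
  csmooth f -> csmooth (fun x => f (L x)).
Proof.
by move=> dL lL [fr fi]; split=> k; [exact: (contdiff_comp_linear dL lL (fr k))|
  exact: (contdiff_comp_linear dL lL (fi k))].
Qed.

Lemma csmooth_fourier_mode (R : realType) (m r : nat) (e : r.-tuple 'M[R]_m)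
    (e_on : forall a b : 'I_r, - \tr (tnth e a *m tnth e b) = (a == b)%:R)
    (Zg : 'rV[R]_r) (psi : 'rV[R]_m -> R[i]) : csmooth psi ->
  csmooth (fourier_mode e Zg psi).
Proof.
move=> ps; apply: csmoothM.
  apply: csmooth_comp_linear => // [x|t u x]; first exact: differentiable_lsubmx.
  by rewrite linearP.
apply: (@csmooth_comp_linear _ _ _ (phase e Zg)); last exact: csmooth_cexpi.
  by have [] := smooth_phase e_on Zg 1.
exact: phase_linear.
Qed.

(** * The action of the Laplacian on Fourier modes *)

(** The exponential is constant along v. The vector [X] is arbitrary, which covers both the
    coordinate directions and the value of J_a at the point. *)
Lemma cderive_vdir_fourier_mode (R : realType) (m r : nat)
    (e : r.-tuple 'M[R]_m) (Zg : 'rV[R]_r) (psi : 'rV[R]_m -> R[i]) X p :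
    cdifferentiable psi ->
  cderive (vdir r X) (fourier_mode e Zg psi) p =
    cderive X psi (lsubmx p) * cexpi (2 * pi * zdot e Zg (rsubmx p)).
Proof.
move=> dpsi; rewrite [RHS]mulrC -cderiveZ//; apply: cderive_line_eq => t.
by rewrite /fourier_mode lsubmx_line_vdir rsubmx_line_vdir mulrC.
Qed.

(** On a central line [psi] is constant, and what remains is [cexpi] on a real line, run at the
    speed given by [phase] on the a-th central vector. *)
Lemma dz_fourier_mode (R : realType) (m r : nat) (e : r.-tuple 'M[R]_m)
    (e_on : forall a b : 'I_r, - \tr (tnth e a *m tnth e b) = (a == b)%:R)
    (Zg : 'rV[R]_r) (a : 'I_r) (psi : 'rV[R]_m -> R[i]) :
  dz a (fourier_mode e Zg psi) =
    (fun p => (2 * pi * Zg 0 a)%:C * 'i%C * fourier_mode e Zg psi p).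
Proof.
apply/funext => p.
have -> : 2 * pi * Zg 0 a = phase e Zg (zdir m (evec a)).
  rewrite /phase /zdir row_mxKr zdotE// /dot (bigD1 a)//= big1 => [|b ba].
    by rewrite addr0 mxE !eqxx mulr1.
  by rewrite mxE (negbTE ba) andbF mulr0.
rewrite /fourier_mode -/(phase e Zg p) mulrCA -cderive_cexpi -cderiveZ; last first.
  exact/csmooth_cdifferentiable/csmooth_cexpi.
apply: cderive_line_eq => t.
by rewrite lsubmx_line_zdir -/(phase e Zg _) phase_linear.
Qed.

(** Bilinear expansion that matches the double sum of the Laplacian, where the derivatives in a and
    b produce the factor Z_a Z_b. *)
Lemma dot_Jact (R : realType) (m r : nat) (e : r.-tuple 'M[R]_m) Z X :
  dot (Jact e Z X) (Jact e Z X) =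
    \sum_a \sum_b Z 0 a * Z 0 b * dot (Jact e (evec a) X) (Jact e (evec b) X).
Proof.
have E i : Jact e Z X 0 i = \sum_a Z 0 a * Jact e (evec a) X 0 i.
  by rewrite JactDl summxE; apply: eq_bigr => a _; rewrite [LHS]mxE.
rewrite /dot; under eq_bigr => i _ do rewrite !E big_distrlr /=.
rewrite exchange_big; apply: eq_bigr => a _ /=.
rewrite exchange_big; apply: eq_bigr => b _ /=.
by rewrite mulr_sumr; apply: eq_bigr => i _; rewrite mulrACA.
Qed.

Lemma mode_coefM (R : realType) (x y : R) :
  (2 * pi * x)%:C * 'i%C * ((2 * pi * y)%:C * 'i%C) =
    (- (4 * pi ^+ 2) * (x * y))%:C :> R[i].
Proof. by apply/eqP; rewrite eq_complex /=; apply/andP; split; apply/eqP; ring. Qed.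

(** The four parts of [nlaplacianE] are evaluated separately. Central derivatives become scalars
    proportional to the coordinates of [Zg], so the sums over a and b fold into the norm of [Zg],
    the norm of J_Zg(X) and the derivative along J_Zg. *)
Lemma nlaplacian_fourier_mode (R : realType) (m r : nat)
    (e : r.-tuple 'M[R]_m) (Zg : 'rV[R]_r) (psi : 'rV[R]_m -> R[i]) p
    (e_on : forall a b : 'I_r, - \tr (tnth e a *m tnth e b) = (a == b)%:R)
    (e_skew : forall a : 'I_r, (tnth e a)^T = - tnth e a) : csmooth psi ->
  nlaplacian e (fourier_mode e Zg psi) p = fourier_mode e Zg (box e Zg psi) p.
Proof.
move=> ps; rewrite nlaplacianE//; last exact: csmooth_fourier_mode.
have dpsi := csmooth_cdifferentiable ps.
set X := lsubmx p; set E := cexpi (2 * pi * zdot e Zg (rsubmx p)).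
pose k a : R[i] := (2 * pi * Zg 0 a)%:C * 'i%C.
pose w := psi X * E.
have Hv : lap_v (fourier_mode e Zg psi) p = lapX psi X * E.
  rewrite /lapX mulr_suml; apply: eq_bigr => i _.
  rewrite -cderive_vdir_fourier_mode; last first.
    exact/csmooth_cdifferentiable/csmooth_cderive.
  congr (cderive _ _ p); apply/funext => q.
  exact: cderive_vdir_fourier_mode.
have dzz a b : dz a (dz b (fourier_mode e Zg psi)) p = k a * k b * w.
  rewrite (dz_fourier_mode e_on Zg b psi) {1}/dz cderiveZ; last first.
    exact/csmooth_cdifferentiable/csmooth_fourier_mode.
  rewrite -/(dz a _ p) dz_fourier_mode// -/(k a) -/(k b).
  by rewrite mulrCA mulrA.
have Hd a : dz a (Dv e a (fourier_mode e Zg psi)) p =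
    k a * (cderive (Jact e (evec a) X) psi X * E).
  (* The field J_a(X) is tangent to v, so its derivative only changes the profile and leaves a mode
     of the same frequency. *)
  have -> : Dv e a (fourier_mode e Zg psi) =
      fourier_mode e Zg (cderive_field (Jact e (evec a)) psi).
    by apply/funext => q; apply: cderive_vdir_fourier_mode.
  by rewrite dz_fourier_mode.
have Hz : lap_z (fourier_mode e Zg psi) p =
    (- (4 * pi ^+ 2) * zdot e Zg Zg)%:C * w.
  rewrite zdotE// /dot mulr_sumr rmorph_sum mulr_suml; apply: eq_bigr => a _.
  by rewrite dzz mode_coefM.
have Hq : \sum_a \sum_b (dot (Jact e (evec a) X) (Jact e (evec b) X))%:C *
      dz a (dz b (fourier_mode e Zg psi)) p =
    (- (4 * pi ^+ 2) * dot (Jact e Zg X) (Jact e Zg X))%:C * w.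
  rewrite dot_Jact mulr_sumr rmorph_sum mulr_suml; apply: eq_bigr => a _.
  rewrite mulr_sumr rmorph_sum mulr_suml; apply: eq_bigr => b _.
  rewrite dzz mode_coefM mulrA -rmorphM; congr (_%:C * _); ring.
have HD : \sum_a dz a (Dv e a (fourier_mode e Zg psi)) p =
    (2 * pi)%:C * 'i%C * cderive_field (Jact e Zg) psi X * E.
  rewrite /cderive_field JactDl (cderive_sum_dir (fun a => Zg 0 a))//.
  rewrite mulr_sumr mulr_suml; apply: eq_bigr => a _; rewrite Hd /k rmorphM.
  by rewrite -!mulrA; congr (_ * _); rewrite mulrCA.
apply: etrans (congr2 +%R (congr2 +%R (congr2 +%R Hv Hz)
  (congr1 ( *%R _) Hq)) HD) _.
rewrite /fourier_mode -/E /box -/X /w.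
(* The potential is split into the two scalars collected in [Hz] and [Hq]; with the analytic terms
   abstracted, a ring identity in [R[i]] remains. *)
have -> : (4 * pi ^+ 2 *
    (zdot e Zg Zg + 4^-1 * dot (Jact e Zg X) (Jact e Zg X)))%:C =
    - ((- (4 * pi ^+ 2) * zdot e Zg Zg)%:C +
       (4^-1)%:C * (- (4 * pi ^+ 2) * dot (Jact e Zg X) (Jact e Zg X))%:C) :> R[i].
  by rewrite -rmorphM -rmorphD -rmorphN; congr (_%:C); ring.
move: (lapX _ _) (psi X) (_%:C * 'i%C * _) (_%:C) (_%:C) (_%:C)
  => x1 x2 x3 x4 x5 x6.
ring.
Qed.

Theorem mainTheorem2 (R : realType) (m r : nat)
    (Jz : {vspace 'M[R]_m}) (e : r.-tuple 'M[R]_m) (Gam : set 'rV[R]_r)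
    (Jz_skew : forall A : 'M[R]_m, A \in Jz -> A^T = - A)
    (e_basis : basis_of Jz e)
    (e_orthonormal : forall a b : 'I_r,
       - \tr (tnth e a *m tnth e b) = (a == b)%:R)
    (Gam_lattice : is_lattice Gam) :
  (forall f : 'rV[R]_(m + r) -> R[i], csmooth f ->
     forall p : 'rV[R]_(m + r),
       nlaplacian e f p =
         lap_v f p + lap_z f p
         + (4^-1)%:C * (\sum_(a < r) \sum_(b < r)
             (dot (Jact e (evec a) (lsubmx p))
                  (Jact e (evec b) (lsubmx p)))%:C * dz a (dz b f) p)
         + \sum_(a < r) dz a (Dv e a f) p)
  /\
  (forall Zg : 'rV[R]_r, Gam Zg ->
     (forall Psi : 'rV[R]_(m + r) -> R[i],
        mode_space e Zg Psi -> mode_space e Zg (nlaplacian e Psi))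
     /\
     (forall psi : 'rV[R]_m -> R[i], csmooth psi ->
        forall (X : 'rV[R]_m) (Z : 'rV[R]_r),
          nlaplacian e (fourier_mode e Zg psi) (row_mx X Z) =
            box e Zg psi X * cexpi (2 * pi * zdot e Zg Z))).
Proof.
have e_skew a : (tnth e a)^T = - tnth e a.
  by apply: Jz_skew; apply: (basis_mem e_basis); exact: mem_tnth.
split=> [f fs p|Zg _]; first exact: nlaplacianE.
split=> [_ [psi ps ->]|psi ps X Z].
  exists (box e Zg psi); first exact: csmooth_box.
  by apply/funext => p; exact: nlaplacian_fourier_mode.
by rewrite nlaplacian_fourier_mode// /fourier_mode row_mxKl row_mxKr.
Qed.
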